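(* For integers $m\ge n\ge 0$ put $$\tilde L'(m,n)=\int_0^1\!\!\int_0^x \ln(x-y)\,p_m(x)\,p_n(y)\,dy\,dx .$$ (i) If $m-n\ge 2$ or $m=n\ne 0$, then $$\tilde L'(m,n)=\frac{(-1)^{m-n}}{(m+n)(m+n+2)\left((m-n)^2-1\right)} .$$ (ii) If $m-n=1$, i.e. $m=n+1$ with $n\ge0$, then $$\tilde L'(n+1,n)=-\frac1q\left(H^{\mathrm{odd}}_{2n+1}-\frac14-\frac1q\right),\qquad q=(2n+1)(2n+3),$$ where $H^{\mathrm{odd}}_{2n+1}=1+\frac13+\dots+\frac1{2n+1}$.
   Context: $P_n$ denotes the Legendre polynomial of degree $n$ (orthogonal on $[-1,1]$, normalized by $P_n(1)=1$), and $p_n(x)=P_n(2x-1)$ is the shifted Legendre polynomial on $[0,1]$. *)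

(* Defs.v *)
From HB Require Import structures.
From mathcomp Require Export all_boot all_order all_algebra.
From mathcomp Require Export all_classical all_reals all_analysis.

Set Implicit Arguments.
Unset Strict Implicit.
Unset Printing Implicit Defensive.

Export Order.TTheory GRing.Theory Num.Theory.
Export numFieldNormedType.Exports.

Local Open Scope classical_set_scope.
Local Open Scope ring_scope.

(* The three clauses determine [P] uniquely. *)
Record legendre_family (R : realType) (P : nat -> {poly R}) : Prop :=
  LegendreFamily {
    legendre_size : forall n, size (P n) = n.+1;
    legendre_orth : forall m n, m != n ->
      \int[lebesgue_measure]_(x in `[-1, 1]) ((P m).[x] * (P n).[x]) = 0;
    legendre_at1 : forall n, (P n).[1] = 1 }.

Definition shifted (R : realType) (P : nat -> {poly R}) (n : nat) (x : R) : R :=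
  (P n).[2 * x - 1].

(* The inner integrand is unbounded as [y] tends to [x]: both integrals are
   Lebesgue integrals, and the value [ln 0 = 0] of the library at [y = x] only
   affects a null set. *)
Definition Ltilde' (R : realType) (P : nat -> {poly R}) (m n : nat) : R :=
  \int[lebesgue_measure]_(x in `[0, 1])
    \int[lebesgue_measure]_(y in `[0, x])
      (ln (x - y) * shifted P m x * shifted P n y).

Definition Hodd (R : realType) (N : nat) : R :=
  \sum_(1 <= k < N.+1 | odd k) k%:R^-1.

(* Main.v *)
From HB Require Import structures.
Require Import Defs.
From mathcomp Require Import measurable_realfun ring lra.
Set Implicit Arguments.
Unset Strict Implicit.
Unset Printing Implicit Defensive.
Local Open Scope ring_scope.

(** For x > 0 and a polynomial g,
      int_0^x ln(x-y) g(y) dy = ln(x) G(x) - S(x),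
    where G is the primitive of g vanishing at 0 and S is a polynomial of the
    same degree as G. Hence int_0^1 int_0^x ln(x-y) f(x) g(y) dy dx equals
      logform f g = int_0^1 ln(x) f G - int_0^1 f S,
    a bilinear form on polynomials that is determined by its values on
    monomials ([logformE]). From there on the argument is algebra.

    Write p_n for the shifted Legendre polynomials and b(m,n) for
    logform p_m p_n. Three facts carry the proof.

    - If m >= n+2, the polynomial S attached to g = p_n has degree n+1 < m and is
      orthogonal to p_m. Moreover the primitive of p_n is
      (p_(n+1) - p_(n-1)) / (2(2n+1)) for n >= 1 and (p_1 + p_0) / 2 for n = 0, so b(m,n) is a combination of two
      integrals of ln(x) p_m p_k with k < m. The Legendre differential equation
      and self-adjointness give
      int_0^1 ln(x) p_m p_k = - (-1)^(m+k) / ((m-k)(m+k+1))  ([logint01_pp]),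
      which yields part (i) off the diagonal ([lform_offdiag]).

    - The kernel ln(x-y) is invariant under the translations (x+t, y+t), so
      logform f' g + logform f g' reduces to boundary terms, and these vanish if
      f(1) = 0 and g(0) = 0 ([logform_by_parts]). For f and g the primitives of p_m
      and p_n, this is a relation between b(m+1,n), b(m-1,n), b(m,n+1) and
      b(m,n-1) ([lform_rec0], [lform_recS]).

    - With m = n+1 that relation links b(n+1,n+1) to b(n,n) through off-diagonal
      values known from the first fact; with m = n+2 it links b(n+2,n+1) to
      b(n+1,n) in the same way. Starting from b(0,0) = -3/4 and b(1,0) = -5/36, induction
      gives the diagonal ([lform_diag]) and part (ii) ([lform_sub]), where the odd
      harmonic sum accumulates one term per step. *)

(** * Linear maps on polynomials given on monomials *)

Section linext.
Variables (R : numFieldType) (V : lmodType R).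
Definition linext (c : nat -> V) (p : {poly R}) : V := \sum_(i < size p) p`_i *: c i.

Lemma linextE c n (p : {poly R}) : (size p <= n)%N -> linext c p = \sum_(i < n) p`_i *: c i.
Proof.
move=> pn; rewrite /linext (big_ord_widen n (fun i => p`_i *: c i) pn) big_mkcond.
apply: eq_bigr => i _; case: ltnP => // /leq_sizeP/(_ _ (leqnn _)) ->.
by rewrite scale0r.
Qed.

Lemma linext_is_linear c : linear (linext c).
Proof.
move=> a p q; pose n := maxn (size (a *: p + q)) (maxn (size p) (size q)).
rewrite !(@linextE c n) ?leq_max ?leqnn ?orbT// scaler_sumr -big_split/=.
by apply: eq_bigr => i _; rewrite coefD coefZ scalerDl scalerA.
Qed.
HB.instance Definition _ c := GRing.isLinear.Build R {poly R} V *:%R (linext c) (linext_is_linear c).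

Lemma linextXn c n : linext c 'X^n = c n.
Proof.
rewrite (@linextE c n.+1) ?size_polyXn// big_ord_recr/= coefXn eqxx scale1r big1 ?add0r// => i _.
by rewrite coefXn ltn_eqF ?scale0r.
Qed.
End linext.

(** Identities that are linear in a polynomial, even between maps that carry no
    bundled linear structure, only have to be checked on monomials. *)
Lemma poly_linear_ind (R : numFieldType) (Pr : {poly R} -> Prop) :
  (forall n, Pr 'X^n) -> (forall a p q, Pr p -> Pr q -> Pr (a *: p + q)) ->
  forall p, Pr p.
Proof.
move=> PX Plin p; rewrite -[p]coefK poly_def.
apply: (big_rec Pr) => [|i q _ Pq]; last exact: Plin.
by rewrite -(addNr ('X^0 : {poly R})) -scaleN1r; exact: Plin.
Qed.

(** * The logarithmic bilinear form *)

Section functionals.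
Variable R : numFieldType.
Implicit Types (a : R) (f g p q : {poly R}).

Definition harm (n : nat) : R := \sum_(i < n) i.+1%:R^-1.

(** [int01 p] and [logint01 p] stand for the integrals over [0, 1] of p(x) and of
    ln(x) p(x). *)
Definition int01 : {poly R} -> R := linext (fun k => k.+1%:R^-1 : R^o).
Definition logint01 : {poly R} -> R := linext (fun k => - (k.+1%:R ^- 2) : R^o).
(** Since int_0^x ln(x-y) y^k dy = (ln(x) - H_(k+1)) x^(k+1) / (k+1), with H_j the
    j-th harmonic number, the same integral with a polynomial g in place of y^k
    is ln(x) (prim g)(x) - (hprim g)(x). *)
Definition prim : {poly R} -> {poly R} := linext (fun k => k.+1%:R^-1 *: 'X^(k.+1)).
Definition hprim : {poly R} -> {poly R} := linext (fun k => (harm k.+1 / k.+1%:R) *: 'X^(k.+1)).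
HB.instance Definition _ := GRing.Linear.copy int01 (linext (fun k => k.+1%:R^-1 : R^o)).
HB.instance Definition _ := GRing.Linear.copy logint01 (linext (fun k => - (k.+1%:R ^- 2) : R^o)).
HB.instance Definition _ := GRing.Linear.copy prim (linext (fun k => k.+1%:R^-1 *: 'X^(k.+1))).
HB.instance Definition _ :=
  GRing.Linear.copy hprim (linext (fun k => (harm k.+1 / k.+1%:R) *: 'X^(k.+1))).

Lemma int01P a p q : int01 (a *: p + q) = a * int01 p + int01 q.
Proof. exact: linearP. Qed.
Lemma int01Z a p : int01 (a *: p) = a * int01 p.
Proof. exact: linearZ. Qed.
Lemma logint01P a p q : logint01 (a *: p + q) = a * logint01 p + logint01 q.
Proof. exact: linearP. Qed.
Lemma logint01Z a p : logint01 (a *: p) = a * logint01 p.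
Proof. exact: linearZ. Qed.
Lemma int01D p q : int01 (p + q) = int01 p + int01 q.
Proof. exact: linearD. Qed.
Lemma int01B p q : int01 (p - q) = int01 p - int01 q.
Proof. exact: linearB. Qed.
Lemma logint01D p q : logint01 (p + q) = logint01 p + logint01 q.
Proof. exact: linearD. Qed.
Lemma logint01B p q : logint01 (p - q) = logint01 p - logint01 q.
Proof. exact: linearB. Qed.
Lemma int01Xn k : int01 'X^k = k.+1%:R^-1. Proof. exact: linextXn. Qed.
Lemma logint01Xn k : logint01 'X^k = - (k.+1%:R ^- 2). Proof. exact: linextXn. Qed.
Lemma primXn k : prim 'X^k = k.+1%:R^-1 *: 'X^(k.+1). Proof. exact: linextXn. Qed.
Lemma hprimXn k : hprim 'X^k = (harm k.+1 / k.+1%:R) *: 'X^(k.+1). Proof. exact: linextXn. Qed.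

Lemma int01_deriv p : int01 p^`() = p.[1] - p.[0].
Proof.
elim/poly_linear_ind: p => [n|a p q hp hq]; last first.
  by rewrite linearP/= int01P hp hq !hornerD !hornerZ; ring.
rewrite derivXn !hornerXn expr1n; case: n => [|n]; first by rewrite mulr0n linear0 expr0 subrr.
by rewrite expr0n subr0 -scaler_nat int01Z int01Xn divff// pnatr_eq0.
Qed.

Lemma prim_deriv p : prim p^`() = p - (p.[0])%:P.
Proof.
elim/poly_linear_ind: p => [n|a p q hp hq]; last first.
  rewrite !linearP/= hp hq hornerD hornerZ polyCD polyCM -mul_polyC scalerBr -!mul_polyC; ring.
rewrite derivXn hornerXn; case: n => [|n]; first by rewrite mulr0n linear0 !expr0 subrr.
by rewrite expr0n subr0 -scaler_nat linearZ/= primXn scalerA divff ?pnatr_eq0// scale1r.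
Qed.

Lemma deriv_prim p : (prim p)^`() = p.
Proof.
elim/poly_linear_ind: p => [n|a p q hp hq]; last by rewrite !linearP/= hp hq.
by rewrite primXn derivZ derivXn -scalerMnr scalerMnl -mulr_natr mulVf ?pnatr_eq0// scale1r.
Qed.

Lemma prim_at0 p : (prim p).[0] = 0.
Proof.
elim/poly_linear_ind: p => [n|a p q hp hq]; last by rewrite !linearP/= !hornerE hp hq mulr0 addr0.
by rewrite primXn hornerZ hornerXn expr0n mulr0.
Qed.

Lemma prim_at1 p : (prim p).[1] = int01 p.
Proof. by rewrite -{2}[p]deriv_prim int01_deriv prim_at0 subr0. Qed.

(** Integration by parts: the factor 'X cancels the derivative 1/x of the
    logarithm, and 'X ln vanishes at both ends of [0, 1]. *)
Lemma logint01_deriv q : logint01 ('X * q)^`() = - int01 q.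
Proof.
elim/poly_linear_ind: q => [n|a p q hp hq].
  rewrite -exprS derivXn -scaler_nat logint01Z logint01Xn int01Xn.
  have n0 : n.+1%:R != 0 :> R by rewrite pnatr_eq0.
  by move: n0; move: (n.+1%:R : R) => c c0; field.
rewrite mulrDr -scalerAr linearP/= logint01P hp hq int01P; ring.
Qed.

Lemma size_hprim p n : (size p <= n)%N -> (size (hprim p) <= n.+1)%N.
Proof.
move=> pn; rewrite /hprim (linextE _ pn); apply: (leq_trans (size_sum _ _ _)).
apply/bigmax_leqP => i _; apply: (leq_trans (size_scale_leq _ _)).
by apply: (leq_trans (size_scale_leq _ _)); rewrite size_polyXn ltnS.
Qed.

(** The algebraic form of int_0^1 int_0^x ln(x-y) f(x) g(y) dy dx. *)
Definition logform f g : R := logint01 (f * prim g) - int01 (f * hprim g).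

Lemma logformPl a f1 f2 g : logform (a *: f1 + f2) g = a * logform f1 g + logform f2 g.
Proof. by rewrite /logform !mulrDl -!scalerAl logint01P int01P; ring. Qed.

Lemma logformPr f a g1 g2 : logform f (a *: g1 + g2) = a * logform f g1 + logform f g2.
Proof. by rewrite /logform !linearP/= !mulrDr -!scalerAr logint01P int01P; ring. Qed.

Lemma logformZl a f g : logform (a *: f) g = a * logform f g.
Proof. by rewrite /logform -!scalerAl logint01Z int01Z; ring. Qed.
Lemma logformZr a f g : logform f (a *: g) = a * logform f g.
Proof. by rewrite /logform !linearZ/= -!scalerAr logint01Z int01Z; ring. Qed.
Lemma logformDl f1 f2 g : logform (f1 + f2) g = logform f1 g + logform f2 g.
Proof. by rewrite -[f1]scale1r logformPl scale1r mul1r. Qed.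
Lemma logformDr f g1 g2 : logform f (g1 + g2) = logform f g1 + logform f g2.
Proof. by rewrite -[g1]scale1r logformPr scale1r mul1r. Qed.
Lemma logformBl f1 f2 g : logform (f1 - f2) g = logform f1 g - logform f2 g.
Proof. by rewrite -scaleN1r logformDl logformZl mulN1r. Qed.
Lemma logformBr f g1 g2 : logform f (g1 - g2) = logform f g1 - logform f g2.
Proof. by rewrite -scaleN1r logformDr logformZr mulN1r. Qed.

Lemma logformXn j k : logform 'X^j 'X^k =
  - (k.+1%:R^-1 * ((j + k).+2%:R ^- 2 + harm k.+1 / (j + k).+2%:R)).
Proof.
rewrite /logform primXn hprimXn -!scalerAr -exprD logint01Z int01Z logint01Xn int01Xn addnS.
by ring.
Qed.

Lemma harmS n : harm n.+1 = harm n + n.+1%:R^-1.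
Proof. by rewrite /harm big_ord_recr. Qed.

(** The vector field d/dx + d/dy annihilates ln(x-y) and is tangent to the
    diagonal side of the triangle 0 <= y <= x <= 1. The side y = 0 contributes
    nothing because 'X * g vanishes there; the side x = 1 contributes f(1) times
    int_0^1 ln(1-y) y g(y) dy, whose value on g = 'X^k is - H_(k+2) / (k+2).
    By bilinearity only monomials have to be compared. *)
Lemma logform_translation f g :
  logform f^`() ('X * g) + logform f ('X * g)^`() =
  f.[1] * linext (fun k => - (harm k.+2 / k.+2%:R) : R^o) g.
Proof.
elim/poly_linear_ind: f g => [j|a f1 f2 h1 h2] g; last first.
  rewrite derivD derivZ !logformPl hornerD hornerZ mulrDl -mulrA -h1 -h2; ring.
rewrite hornerXn expr1n mul1r.
elim/poly_linear_ind: g => [k|a g1 g2 h1 h2]; last first.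
  rewrite mulrDr -scalerAr derivD derivZ !logformPr [RHS]linearP/= -h1 -h2 /GRing.scale/=; ring.
have dX n : 'X^(n.+1)^`() = n.+1%:R *: 'X^n :> {poly R} by rewrite derivXn -scaler_nat.
have n0 n : n.+1%:R != 0 :> R by rewrite pnatr_eq0.
have e1 : k.+2%:R = k.+1%:R + 1 :> R by rewrite -natr1.
rewrite linextXn -exprS dX logformZr logformXn [harm k.+2]harmS e1.
have := n0 k; have := n0 k.+1; rewrite e1.
case: j => [|j].
  have l0 f : logform 0 f = 0 by rewrite /logform !mul0r !linear0 addr0.
  rewrite expr0 derivC l0 add0r !add0n e1.
  move: (k.+1%:R : R) (harm _) => c h c1 c0; field; by rewrite c0 c1.
rewrite dX logformZl logformXn addSn !addnS [harm k.+2]harmS e1.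
have e2 : (j + k).+3%:R = j.+1%:R + k.+1%:R + 1 :> R by rewrite -natrD natr1 addSn addnS.
have := n0 (j + k).+2; rewrite e2.
move: (k.+1%:R : R) (j.+1%:R : R) (harm _) => c d h d0 c1 c0; field; by rewrite c0 c1 d0.
Qed.

Lemma logform_by_parts f g : f.[1] = 0 -> g.[0] = 0 ->
  logform f^`() g + logform f g^`() = 0.
Proof.
move=> f1; elim/poly_ind: g => [|g c _].
  by rewrite deriv0 => _; rewrite /logform !linear0 !mulr0 !linear0 !addr0.
rewrite hornerD hornerM hornerX mulr0 add0r hornerC => ->.
by rewrite addr0 commr_polyX logform_translation f1 mul0r.
Qed.
End functionals.

(** * Shifted Legendre polynomials from orthogonality *)

Section Legendre.
Variables (R : numFieldType) (p : nat -> {poly R}).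
Hypothesis size_p : forall n, size (p n) = n.+1.
Hypothesis orth_p : forall m n, m != n -> int01 (p m * p n) = 0.
Hypothesis p_at1 : forall n, (p n).[1] = 1.
Implicit Types (q r : {poly R}) (m n k : nat).

Let natS0 n : n.+1%:R != 0 :> R. Proof. by rewrite pnatr_eq0. Qed.

Lemma lead_neq0 n : (p n)`_n != 0.
Proof.
have : lead_coef (p n) != 0 by rewrite lead_coef_eq0 -size_poly_eq0 size_p.
by rewrite lead_coefE size_p.
Qed.

Definition lead_quot n q : R := q`_n / (p n)`_n.

(** Subtracting a multiple of p_n lowers the degree: this one-step expansion in
    the basis (p_n) drives the inductions of this part. *)
Lemma size_reduce n q : (size q <= n.+1)%N -> (size (q - lead_quot n q *: p n)%R <= n)%N.
Proof.
move=> qn; apply/leq_sizeP => j; rewrite leq_eqVlt => /predU1P[<-|nj].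
  by rewrite coefB coefZ divfK ?subrr ?lead_neq0.
by rewrite coefB coefZ !nth_default ?mulr0 ?subrr ?size_p// (leq_trans qn).
Qed.

Lemma orth_low n q : (size q <= n)%N -> int01 (p n * q) = 0.
Proof.
suff H k : (k <= n)%N -> forall q, (size q <= k)%N -> int01 (p n * q) = 0 by exact: (H n).
elim: k => [_|k IH kn] {}q qk.
  by move: qk; rewrite leqn0 size_poly_eq0 => /eqP ->; rewrite mulr0 linear0.
have := IH (ltnW kn) _ (size_reduce qk).
rewrite mulrBr int01B -scalerAr int01Z orth_p ?mulr0 ?subr0//.
by rewrite gtn_eqF.
Qed.

Lemma size_deriv_le n q : (size q <= n.+1)%N -> (size q^`() <= n)%N.
Proof.
by move=> h; apply/leq_sizeP => j nj; rewrite coef_deriv nth_default ?mul0rn// (leq_trans h).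
Qed.

Lemma size_dp n : (size (p n)^`() <= n)%N.
Proof. by apply: size_deriv_le; rewrite size_p. Qed.

(** x p_n' - n p_n has degree below n, so int x p_n p_n' = n int p_n^2. On the
    other hand the derivative of x p_n^2 integrates to p_n(1)^2 = 1, which gives
    (1 + 2n) int p_n^2 = 1. *)
Lemma int01_norm n : int01 (p n * p n) = (2 * n%:R + 1)^-1.
Proof.
have h1 : (size ('X * (p n)^`() - n%:R *: p n)%R <= n)%N.
  apply/leq_sizeP => -[|j]; rewrite coefB coefXM coefZ/=.
    by rewrite leqn0 => /eqP ->; rewrite mul0r subrr.
  rewrite coef_deriv leq_eqVlt => /predU1P[->|nj]; first by rewrite mulr_natl subrr.
  by rewrite nth_default ?size_p// mulr0 mul0rn subrr.
have := orth_low h1; rewrite mulrBr int01B -scalerAr int01Z => /eqP; rewrite subr_eq0 => /eqP h2.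
have := int01_deriv ('X * (p n * p n)).
rewrite !hornerM hornerX p_at1 !mulr1 hornerX mul0r subr0 !derivM derivX mul1r.
have -> : p n * p n + 'X * ((p n)^`() * p n + p n * (p n)^`())
  = p n * p n + (2 : R) *: (p n * ('X * (p n)^`())) by rewrite scaler_nat; ring.
rewrite int01D int01Z h2 => h3.
have c0 : 2 * n%:R + 1 != 0 :> R by rewrite -natrM natr1.
by apply: (mulfI c0); rewrite divff// -[RHS]h3; ring.
Qed.

(** The uniqueness principle that identifies polynomials below. It rests on
    int p_n^2 being nonzero: the leading coefficients of r in the basis (p_n) vanish
    one after the other. *)
Lemma ortho_eq0 n r : (size r <= n)%N ->
  (forall k, (k < n)%N -> int01 (r * p k) = 0) -> r = 0.
Proof.
elim: n r => [|n IH] r rn hr.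
  by move: rn; rewrite leqn0 size_poly_eq0 => /eqP.
have hq := size_reduce rn.
have c0 : lead_quot n r = 0.
  have := hr n (ltnSn n); rewrite -[r in int01 (r * _)](subrK (lead_quot n r *: p n)) mulrDl int01D.
  rewrite [_ * p n]mulrC orth_low// add0r -scalerAl int01Z int01_norm => /eqP.
  rewrite mulf_eq0 invr_eq0 -natrM natr1 (negbTE (natS0 _)) orbF => /eqP //.
apply: IH => [|k kn]; last by apply: hr; rewrite ltnS ltnW.
by move: hq; rewrite c0 scale0r subr0.
Qed.

Lemma int01_parts q r : int01 (q^`() * r) = q.[1] * r.[1] - q.[0] * r.[0] - int01 (q * r^`()).
Proof. by rewrite -!hornerM -int01_deriv derivM int01D addrK. Qed.

(** The derivatives of (x-1) p_n^2 and of x p_n^2 differ by 2 p_n p_n', whose integral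
    is 0 since p_n' has degree below n; the boundary terms are p_n(0)^2 and
    p_n(1)^2. *)
Lemma p_at0_sq n : (p n).[0] ^+ 2 = 1.
Proof.
have := int01_deriv (('X - 1) * (p n * p n)).
rewrite !hornerM !hornerD !hornerX !hornerN !hornerC subrr mul0r !derivM derivB derivX derivC.
have -> : (1 - 0) * (p n * p n) + ('X - 1) * ((p n)^`() * p n + p n * (p n)^`())
  = ((p n * p n) + 'X * ((p n)^`() * p n + p n * (p n)^`()))
   - (2 : R) *: (p n * (p n)^`()) by rewrite scaler_nat; ring.
have -> : (p n * p n) + 'X * ((p n)^`() * p n + p n * (p n)^`()) = ('X * (p n * p n))^`().
  by rewrite !derivM derivX; ring.
rewrite int01B int01Z orth_low ?size_dp// int01_deriv !hornerM !hornerX p_at1.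
by move=> h; apply: etrans (_ : _ = 0 - (0 - 1) * ((p n).[0] * (p n).[0])) _; [ring|rewrite -h; ring].
Qed.

(** The values at 0 are signs, so it suffices to exclude
    p_(n+1)(0) p_n(0) = 1. By parts, int p_(n+1)' p_n = 1 - p_(n+1)(0) p_n(0), and
    this integral is the norm of p_n times a ratio of leading coefficients,
    hence nonzero. *)
Lemma p_at0_step n : (p n.+1).[0] = - (p n).[0].
Proof.
have h : int01 ((p n.+1)^`() * p n) != 0.
  rewrite -[(p n.+1)^`()](subrK (lead_quot n (p n.+1)^`() *: p n)) mulrDl int01D.
  rewrite [_ * p n]mulrC orth_low ?size_reduce ?size_dp// add0r -scalerAl int01Z int01_norm.
  apply: mulf_neq0; last by rewrite invr_eq0 -natrM natr1.
  rewrite /lead_quot coef_deriv -mulr_natr; apply: mulf_neq0; last by rewrite invr_eq0 lead_neq0.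
  by apply: mulf_neq0; rewrite ?lead_neq0.
move: h; rewrite int01_parts !p_at1 orth_low; last by rewrite (leq_trans (size_dp _)).
rewrite mulr1 subr0 subr_eq0 eq_sym => h.
have := p_at0_sq n.+1; have := p_at0_sq n.
move: h; move: (p n.+1).[0] (p n).[0] => a b h hb ha.
have : (a * b - 1) * (a * b + 1) = 0.
  by transitivity (a ^+ 2 * b ^+ 2 - 1); [ring|rewrite ha hb mulr1 subrr].
move/eqP; rewrite mulf_eq0 subr_eq0 (negbTE h)/= addr_eq0 => /eqP hab.
transitivity (a * b ^+ 2); first by rewrite hb mulr1.
by rewrite expr2 mulrA hab; ring.
Qed.

Lemma p0E : p 0 = 1.
Proof.
have := size_p 0 => /eqP/size_poly1P [c c0 hc].
by have := p_at1 0; rewrite hc hornerC => ->.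
Qed.

Lemma p_at0 n : (p n).[0] = (-1) ^+ n.
Proof.
elim: n => [|n IH]; first by rewrite p0E hornerC.
by rewrite p_at0_step IH exprS mulN1r.
Qed.

Lemma int01_dp m k : (k <= m)%N -> int01 ((p m)^`() * p k) = 1 - (-1) ^+ (m + k).
Proof.
move=> km; rewrite int01_parts !p_at1 !p_at0 -exprD orth_low ?mulr1 ?subr0//.
exact: leq_trans (size_dp _) km.
Qed.

(** Both sides have degree at most n+1 and, by [int01_dp], the same integral
    against p_k for each k <= n+1: for k <= n those of p_(n+2)' and p_n' agree, and
    for k = n+1 the factor 2(2n+3) compensates the norm of p_(n+1). *)
Lemma p_deriv_rel n : (p n.+2)^`() - (p n)^`() = (2 * (2 * n%:R + 3)) *: p n.+1.
Proof.
apply/eqP; rewrite -subr_eq0; apply/eqP; apply: (@ortho_eq0 n.+2).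
  apply: (leq_trans (size_polyD _ _)); rewrite geq_max size_polyN; apply/andP; split.
    apply: (leq_trans (size_polyD _ _)); rewrite geq_max size_polyN size_dp.
    by rewrite (leq_trans (size_dp _))// leqW.
  by apply: (leq_trans (size_scale_leq _ _)); rewrite size_p.
move=> k; rewrite ltnS => kn.
rewrite !mulrBl !int01B -scalerAl int01Z int01_dp ?(leq_trans kn)//.
move: kn; rewrite leq_eqVlt => /predU1P[->|]; last first.
  rewrite ltnS => kn; rewrite int01_dp// orth_p ?gtn_eqF// !addSn !exprS; ring.
rewrite [_ * p n.+1]mulrC orth_low ?(leq_trans (size_dp _))// int01_norm addSn addnS !exprS.
rewrite exprD -expr2 sqrr_sign -[n.+1%:R]natr1.
have := natS0 (n.+1 * 2); rewrite -natr1 natrM -natr1.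
by move: (n%:R : R) => c c0; field; apply: contraNneq c0 => <-; apply/eqP; ring.
Qed.

Lemma prim_pS n : prim (p n.+1) = (2 * (2 * n%:R + 3))^-1 *: (p n.+2 - p n).
Proof.
have c0 : 2 * (2 * n%:R + 3) != 0 :> R.
  by rewrite -!natrM -natrD -natrM addn3 mulnS pnatr_eq0.
have := prim_deriv (p n.+2 - p n).
rewrite derivB p_deriv_rel linearZ/= hornerD hornerN !p_at0.
have -> : (-1) ^+ n.+2 - (-1) ^+ n = 0 :> R by rewrite !exprS; ring.
by rewrite subr0 => <-; rewrite scalerA mulVf// scale1r.
Qed.

Lemma p1_deriv : (p 1)^`() = (2 : R) *: p 0.
Proof.
have [c h] : exists c, (p 1)^`() = c%:P.
  by exists (p 1)^`()`_0; exact: size1_polyC (size_dp 1).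
rewrite h p0E.
have := int01_deriv (p 1); rewrite p_at0 p_at1 h expr1 opprK.
have -> : c%:P = c *: 'X^0 by rewrite expr0 alg_polyC.
by rewrite int01Z int01Xn invr1 mulr1 expr0 => ->.
Qed.

Lemma prim_p0 : prim (p 0) = 2^-1 *: (p 1 + p 0).
Proof.
have := prim_deriv (p 1); rewrite p1_deriv linearZ/= p_at0 expr1 polyCN opprK p0E => <-.
by rewrite scalerA mulVf ?scale1r// pnatr_eq0.
Qed.

(** The Legendre operator on [0, 1], f |-> (x (1-x) f')'. *)
Definition legendre_op q : {poly R} := ('X * ((1 - 'X) * q^`()))^`().

Lemma coef_legendre_op q i : (legendre_op q)`_i = (i.+1 ^ 2)%:R * q`_i.+1 - (i * i.+1)%:R * q`_i.
Proof.
rewrite /legendre_op coef_deriv coefXM/= mulrBl mul1r coefB coefXM !coef_deriv.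
case: i => [|i]/=; first by rewrite mul0n mul0r !subr0 mul1r.
by rewrite -mulr_natr -[_ *+ i.+2]mulr_natr -[_ *+ i.+1]mulr_natr natrX natrM; ring.
Qed.

(** The difference of the two integrands is the derivative of
    x (1-x) (q' r - q r'), which vanishes at 0 and at 1. *)
Lemma legendre_op_sym q r : int01 (legendre_op q * r) = int01 (q * legendre_op r).
Proof.
apply/eqP; rewrite -subr_eq0 -int01B; apply/eqP.
have -> : legendre_op q * r - q * legendre_op r = ('X * ((1 - 'X) * (q^`() * r - q * r^`())))^`().
  rewrite /legendre_op !derivM !derivB !derivM derivC derivX; ring.
by rewrite int01_deriv !hornerM !hornerX hornerD hornerN hornerX hornerC subrr !mul0r mulr0 subrr.
Qed.

Lemma size_legendre_op n q : (size q <= n)%N -> (size (legendre_op q) <= n)%N.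
Proof.
move=> qn; apply/leq_sizeP => j nj.
by rewrite coef_legendre_op !nth_default ?mulr0 ?subrr ?(leq_trans qn)// leqW.
Qed.

(** The operator is self-adjoint and does not raise degrees, so D p_n is
    orthogonal to every p_k with k < n, hence a multiple of p_n; the factor is
    read off the leading coefficient. *)
Lemma legendre_op_p n : legendre_op (p n) = - (n * n.+1)%:R *: p n.
Proof.
apply/eqP; rewrite -subr_eq0 scaleNr opprK; apply/eqP.
apply: (@ortho_eq0 n) => [|k kn].
  apply/leq_sizeP => j; rewrite coefD coefZ coef_legendre_op.
  rewrite leq_eqVlt => /predU1P[<-|nj].
    rewrite [_`_n.+1]nth_default ?size_p//; ring.
  by rewrite !nth_default ?size_p ?(leqW nj)//; ring.
rewrite mulrDl int01D -scalerAl int01Z legendre_op_sym orth_p ?gtn_eqF// mulr0 addr0.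
by rewrite orth_low// size_legendre_op// size_p.
Qed.

(** By the differential equation, (m(m+1) - k(k+1)) int ln(x) p_m p_k is minus
    the integral of ln(x) times the derivative of x (1-x) w, where
    w = p_m' p_k - p_m p_k'. By parts this is int (1-x) w. As k < m, orthogonality leaves
    only the boundary term - p_m(0) p_k(0) = - (-1)^(m+k), and
    m(m+1) - k(k+1) = (m-k)(m+k+1). *)
Lemma logint01_pp m k : (k < m)%N ->
  logint01 (p m * p k) = - (-1) ^+ (m + k) / ((m%:R - k%:R) * (m%:R + k%:R + 1)).
Proof.
move=> km.
pose w := (p m)^`() * p k - p m * (p k)^`().
have h : legendre_op (p m) * p k - p m * legendre_op (p k) = ('X * ((1 - 'X) * w))^`().
  rewrite /w /legendre_op !derivM !derivB !derivM derivC derivX; ring.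
have size_mul_1mX q n : (size q <= n)%N -> (size ((1 - 'X) * q)%R <= n.+1)%N.
  move=> qn; apply: (leq_trans (size_polyMleq _ _)).
  by rewrite -opprB size_polyN size_XsubC.
have e1 : int01 ((1 - 'X) * w) = - (-1) ^+ (m + k).
  have -> : (1 - 'X) * w = (p m)^`() * ((1 - 'X) * p k) - p m * ((1 - 'X) * (p k)^`()).
    by rewrite /w; ring.
  rewrite int01B [int01 (p m * _)]orth_low ?subr0; last first.
    by apply: leq_trans (size_mul_1mX _ _ (size_dp k)) _.
  rewrite int01_parts [int01 (p m * _)]orth_low; last first.
    apply: size_deriv_le; apply: leq_trans (size_mul_1mX _ k.+1 _) _; by rewrite ?size_p.
  rewrite !hornerM !hornerD !hornerN !hornerX !hornerC !p_at0 exprD; ring.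
have := logint01_deriv ((1 - 'X) * w).
rewrite -h !legendre_op_p e1 opprK -scalerAl -scalerAr -scalerBl logint01Z => <-.
have mk0 : (m%:R - k%:R : R) != 0 by rewrite subr_eq0 eqr_nat gtn_eqF.
have mk1 : (m%:R + k%:R + 1 : R) != 0 by rewrite -natrD natr1.
rewrite !natrM -[m.+1%:R]natr1 -[k.+1%:R]natr1.
by field; rewrite mk0 mk1.
Qed.

(** * The form on pairs of Legendre polynomials *)

Definition lform m n := logform (p m) (p n).

(** The polynomial [hprim (p n)] has degree n+1 < m, so only the logarithmic part
    of the form survives; expanding the primitive of p_n in Legendre polynomials
    reduces it to [logint01_pp]. *)
Lemma lform_offdiag m n : (n.+2 <= m)%N ->
  lform m n = (-1) ^+ (m + n) /
    ((m%:R + n%:R) * (m%:R + n%:R + 2) * ((m%:R - n%:R) ^+ 2 - 1)).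
Proof.
move=> nm; rewrite /lform /logform [int01 _]orth_low ?subr0; last first.
  by apply: leq_trans nm; apply: size_hprim; rewrite size_p.
have km k : (k <= n.+1)%N -> m%:R - k%:R != 0 :> R.
  by move=> kn; rewrite subr_eq0 eqr_nat gtn_eqF// (leq_trans _ nm).
have mk j : m%:R + j%:R != 0 :> R.
  by rewrite -natrD pnatr_eq0 addn_eq0 negb_and -lt0n (leq_trans _ nm).
(* The primitive of p_0 is (p_1 + p_0)/2, not of the general shape. *)
case: n nm km => [|n] nm km.
  rewrite prim_p0 -scalerAr logint01Z mulrDr logint01D.
  rewrite !logint01_pp ?(leq_trans _ nm)// addn1 addn0 exprS.
  have := km 1%N isT; have := km 0%N isT; have := mk 0%N; have := mk 1%N; have := mk 2%N.
  move: (m%:R : R) ((-1) ^+ m) => c s; rewrite !addr0 !subr0 => c2 c1 c0 _ cm.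
  have -> : c ^+ 2 - 1 = (c - 1) * (c + 1) by ring.
  have h2 : 2 != 0 :> R by rewrite pnatr_eq0.
  have -> : c + 1 + 1 = c + 2 by ring.
  field; by rewrite ?c0 ?c1 ?c2 ?cm ?h2.
rewrite prim_pS -scalerAr logint01Z mulrBr logint01B.
have nm' : (n < m)%N by rewrite (leq_trans _ nm)// ltnW.
rewrite (logint01_pp nm) (logint01_pp nm') !addnS.
rewrite (_ : (-1) ^+ (m + n).+2 = (-1) ^+ (m + n)) ?(exprS _ (m + n)); last by rewrite !exprS; ring.
have := km n.+2 (leqnn _); have := km n (leqW (leqnSn _)); have := mk n.+3; have := mk n.+1.
have h3 : 2 * n%:R + 3 != 0 :> R by rewrite -natrM -natrD addn3 pnatr_eq0.
have h2 : 2 != 0 :> R by rewrite pnatr_eq0.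
rewrite -(natr1 n.+2) -(natr1 n.+1) -(natr1 n).
move: h3; move: (m%:R : R) (n%:R : R) ((-1) ^+ _) => c d s h3 c1 c3 k0 k2.
have e1 : (c - (d + 1)) ^+ 2 - 1 = (c - (d + 1 + 1)) * (c - d) by ring.
have e2 : c + (d + 1) + 2 = c + (d + 1 + 1 + 1) by ring.
have e3 : c + (d + 1 + 1) + 1 = c + (d + 1 + 1 + 1) by ring.
have e4 : c + d + 1 = c + (d + 1) by ring.
by rewrite e1 e2 e3 e4; field; rewrite ?c1 ?c3 ?k0 ?k2 ?h3 ?h2.
Qed.

(** The primitive of p_(m+1) vanishes at 1 because p_(m+1) is orthogonal to
    p_0 = 1; the primitive of p_0 does not, which is why the index starts at 1. *)
Lemma lform_by_parts m n : logform (p m.+1) (prim (p n)) + logform (prim (p m.+1)) (p n) = 0.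
Proof.
have := @logform_by_parts _ (prim (p m.+1)) (prim (p n)); rewrite !deriv_prim; apply.
  by rewrite prim_at1 -[p m.+1]mulr1 -p0E orth_p.
exact: prim_at0.
Qed.

Lemma lform_rec0 m :
  lform m.+2 0 - lform m 0 + (2 * m%:R + 3) * (lform m.+1 1 + lform m.+1 0) = 0.
Proof.
have := lform_by_parts m 0; rewrite prim_p0 prim_pS logformZr logformDr logformZl logformBl.
rewrite -!/(lform _ _) => h.
have h3 : 2 * m%:R + 3 != 0 :> R by rewrite -natrM -natrD addn3 pnatr_eq0.
have h2 : 2 != 0 :> R by rewrite pnatr_eq0.
(* h is the goal divided by the denominators of the two primitives. *)
apply: (mulfI (_ : (2 * (2 * m%:R + 3))^-1 != 0)); first by rewrite invr_eq0 mulf_neq0.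
rewrite mulr0 -[RHS]h; by field; rewrite ?h3 ?h2.
Qed.

Lemma lform_recS m n :
  (2 * n%:R + 3) * (lform m.+2 n.+1 - lform m n.+1) +
  (2 * m%:R + 3) * (lform m.+1 n.+2 - lform m.+1 n) = 0.
Proof.
have := lform_by_parts m n.+1; rewrite !prim_pS logformZr logformBr logformZl logformBl.
rewrite -!/(lform _ _) => h.
have h3 k : 2 * k%:R + 3 != 0 :> R by rewrite -natrM -natrD addn3 pnatr_eq0.
have h2 : 2 != 0 :> R by rewrite pnatr_eq0.
apply: (mulfI (_ : (2 * (2 * m%:R + 3) * (2 * n%:R + 3))^-1 != 0)).
  by rewrite invr_eq0 !mulf_neq0.
have := h3 m; have := h3 n => hn hm.
rewrite mulr0 -[RHS]h; by field; rewrite ?hn ?hm ?h2.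
Qed.

Lemma p1E : p 1 = 2 *: 'X - 1.
Proof.
have h := prim_deriv (p 1).
rewrite p1_deriv linearZ/= p0E -(expr0 'X) primXn invr1 scale1r expr1 p_at0 expr1 polyCN opprK in h.
by rewrite h addrK.
Qed.

Lemma lform00 : lform 0 0 = - (3 / 4).
Proof.
rewrite /lform p0E -(expr0 'X) logformXn /harm big_ord1 addn0 invr1.
by field.
Qed.

Lemma lform10 : lform 1 0 = - (5 / 36).
Proof.
rewrite /lform p1E p0E logformBl logformZl.
rewrite (logformXn R 1 0 : logform 'X 1 = _) (logformXn R 0 0 : logform 1 1 = _).
rewrite /harm !big_ord1 /= !addn0 invr1.
by field.
Qed.

(** [lform_offdiag] in terms of the distance d+2 to the diagonal; the
    recurrences only use distances 2 and 3. *)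
Lemma lform_gap n d : lform (n + d.+2) n =
  (-1) ^+ d / ((2 * n%:R + d%:R + 2) * (2 * n%:R + d%:R + 4) * ((d%:R + 1) * (d%:R + 3))).
Proof.
rewrite lform_offdiag ?addnS ?ltnS ?leq_addr// !addSn addnAC addnn -mul2n.
rewrite !exprS exprD exprM sqrrN !expr1n.
rewrite -(natr1 (n + d).+1) -(natr1 (n + d)) natrD; congr (_ / _); first ring.
ring.
Qed.

Lemma lform_gap2 n : lform n.+2 n = ((2 * n%:R + 2) * (2 * n%:R + 4) * 3)^-1.
Proof. by have := lform_gap n 0; rewrite addn2 expr0 div1r !addr0 add0r mul1r add0r. Qed.

Lemma lform_gap3 n : lform n.+3 n = - ((2 * n%:R + 3) * (2 * n%:R + 5) * 8)^-1.
Proof.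
have := lform_gap n 1; rewrite addn3 expr1 mulN1r => ->; congr (- _^-1); ring.
Qed.

Let lin_neq0 a b : 2 * a%:R + b.+1%:R != 0 :> R.
Proof. by rewrite -natrM -natrD addnS. Qed.

(** [lform_recS] at (n+1, n) involves b(n+2,n+2), b(n+1,n+1) and two values at
    distance 2 from the diagonal. *)
Lemma lform_diag n :
  lform n.+1 n.+1 = - ((2 * n%:R + 2) * (2 * n%:R + 4))^-1.
Proof.
elim: n => [|n IH].
  have := lform_rec0 0; rewrite lform_gap2 lform00 lform10 => h.
  (* The multiple of 0 is there to be replaced by the relation h. *)
  have -> : lform 1 1 = - (1 / 8) + 3^-1 * 0 by rewrite -h; field.
  by field.
have := lform_recS n.+1 n; rewrite IH !lform_gap2 -(natr1 n).
have := lin_neq0 n 1; have := lin_neq0 n 3; have := lin_neq0 n 4; have := lin_neq0 n 5.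
move: (n%:R : R) (lform _ _) => c b h6 h5 h4 h2 h.
have -> : b = (2 * (c + 1) + 3)^-1 * 0 - ((2 * (c + 1) + 2) * (2 * (c + 1) + 4))^-1.
  rewrite -h.
  have -> : 2 * (c + 1) + 3 = 2 * c + 5 by ring.
  have -> : 2 * (c + 1) + 2 = 2 * c + 4 by ring.
  have -> : 2 * (c + 1) + 4 = 2 * c + 6 by ring.
  by field; rewrite ?h6 ?h5 ?h4 ?h2.
by rewrite mulr0 sub0r.
Qed.

(** [lform_recS] at (n+2, n) involves b(n+3,n+2), b(n+2,n+1) and two values at
    distance 3 from the diagonal. It starts at n = 0, so b(2,1) is obtained
    separately from [lform_rec0]. *)
Lemma lform_sub n (q := (2 * n%:R + 1) * (2 * n%:R + 3) : R) :
  lform n.+1 n = - (1 / q) * ((\sum_(i < n.+1) (2 * i%:R + 1)^-1) - 1 / 4 - 1 / q).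
Proof.
rewrite /q {q}; elim/ltn_ind: n => -[|[|n]] IH.
- by rewrite lform10 big_ord1 /=; field.
- have := lform_rec0 1; rewrite lform_gap3 lform_gap2 lform10 => h.
  rewrite 2!big_ord_recr big_ord0 /=.
  have -> : lform 2 1 = (1 / 120 - 5 / 36) / 5 - 1 / 24 + 5^-1 * 0 by rewrite -h; field.
  by field.
have := lform_recS n.+2 n; rewrite (IH n.+1)// !lform_gap3 {IH}.
rewrite [\sum_(i < n.+3) _]big_ord_recr/=.
have := lin_neq0 n 0; have := lin_neq0 n 2; have := lin_neq0 n 4; have := lin_neq0 n 6.
rewrite -(natr1 n.+1) -(natr1 n).
move: (n%:R : R) (lform _ _) (\sum_(i < _) _) => c b s h7 h5 h3 h1 h.
have e1 : 2 * (c + 1) + 1 = 2 * c + 3 by ring.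
have e3 : 2 * (c + 1) + 3 = 2 * c + 5 by ring.
have e5 : 2 * (c + 1) + 5 = 2 * c + 7 by ring.
have f1 : 2 * (c + 1 + 1) + 1 = 2 * c + 5 by ring.
have f3 : 2 * (c + 1 + 1) + 3 = 2 * c + 7 by ring.
move: h; rewrite e1 e3 e5 f1 f3 => h.
set rhs := RHS.
have -> : b = (2 * c + 7)^-1 * 0 + rhs.
  by rewrite -h /rhs; field; rewrite ?h7 ?h5 ?h3 ?h1.
by rewrite mulr0 add0r.
Qed.
End Legendre.

Local Open Scope classical_set_scope.
Local Open Scope ring_scope.

(** * Improper integrals with a logarithmic singularity *)

Section improper.
Variable R : realType.
Notation mu := (@lebesgue_measure R).

(** Bundling integrability with the value makes the rules below composable,
    since the integral is additive only on integrable functions. *)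
Definition has_integral (a b : R) (f : R -> R) (v : R) :=
  mu.-integrable `[a, b] (EFin \o f) /\ \int[mu]_(x in `[a, b]) f x = v.

(** The fundamental theorem of calculus for a nonnegative integrand that may be
    unbounded at both ends: apply the compact version on [u_n, v_n] with u_n -> a
    and v_n -> b, and pass to the limit, in the integrals by monotone convergence and in
    F(v_n) - F(u_n) by continuity of F at a and b. Integrability comes for free from
    nonnegativity. *)
Lemma ge0_has_integral (f F : R -> R) (a b : R) : a < b ->
  {in `]a, b[, continuous f} ->
  {in `]a, b[, forall x, 0 <= f x} ->
  derivable_oo_LRcontinuous F a b ->
  {in `]a, b[, F^`()%classic =1 f} ->
  has_integral a b f (F b - F a).
Proof.
move=> ab cf f0 [dF Fa Fb] dFE.
(* A third of the length keeps u_0 < v_0. *)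
pose d := (b - a) / 3.
have d0 : 0 < d by rewrite /d; lra.
have bE3 : b = a + 3 * d by rewrite /d; lra.
move: d d0 bE3 => d d0 bE3.
pose u (n : nat) := a + d * n.+1%:R^-1.
pose v (n : nat) := b - d * n.+1%:R^-1.
have uv n : [/\ a < u n, u n < v n & v n < b].
  have e0 : 0 < d * n.+1%:R^-1 by rewrite mulr_gt0// invr_gt0.
  have : d * n.+1%:R^-1 <= d by rewrite ler_piMr ?(ltW d0)// invf_le1// ler1n.
  rewrite /u /v; move: (d * n.+1%:R^-1) e0 => t e0 e1; split; lra.
have cu : u @ \oo --> a.
  rewrite -[X in _ --> X]addr0 -[X in _ + X](mulr0 d); apply: cvgD; first exact: cvg_cst.
  by apply: cvgM; [exact: cvg_cst|exact: cvg_harmonic].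
have cv : v @ \oo --> b.
  rewrite -[X in _ --> X]subr0 -[X in _ - X](mulr0 d); apply: cvgB; first exact: cvg_cst.
  by apply: cvgM; [exact: cvg_cst|exact: cvg_harmonic].
pose E n := `[u n, v n]%classic.
have subE n x : x \in `[u n, v n] -> x \in `]a, b[.
  have [au _ vb] := uv n; rewrite !in_itv/= => /andP[ux xv].
  by rewrite (lt_le_trans au ux) (le_lt_trans xv vb).
have bE : \bigcup_n E n = `]a, b[%classic.
  apply/seteqP; split => [x [n _]|x /=]; first exact: subE.
  rewrite in_itv/= => /andP[ax xb].
  have : \forall n \near \oo, u n <= x /\ x <= v n.
    near=> n; split.
      by near: n; exact: cvgr_le cu _ ax.
    by near: n; exact: cvgr_ge cv _ xb.
  by case=> N _ /(_ N (leqnn _)) [? ?]; exists N => //=; rewrite /E/= in_itv/=; apply/andP.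
have mE n : measurable (E n) by exact: measurable_itv.
have mf : measurable_fun `]a, b[ f.
  by apply: open_continuous_measurable_fun => // x; rewrite inE; exact: cf.
have int_E n : (\int[mu]_(x in E n) (f x)%:E = (F (v n) - F (u n))%:E)%E.
  have [? ? ?] := uv n.
  rewrite EFinB /E (@continuous_FTC2 _ f F)//.
  - apply: continuous_in_subspaceT => x /[!inE] xE; apply: cf; exact: (subE n).
  - have : {within `[u n, v n], continuous F}.
      apply: derivable_within_continuous => x xE; apply: dF; exact: (subE n).
    move=> /continuous_within_itvP => /(_ (ltac:(done))) [_ ? ?]; split => // x xE.
    by apply: dF; apply/(subE n)/subset_itv_oo_cc.
  - by move=> x xE; apply: dFE; apply/(subE n)/subset_itv_oo_cc.
have int_oo : (\int[mu]_(x in `]a, b[) (f x)%:E = (F b - F a)%:E)%E.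
  have h1 : (\int[mu]_(x in E i) (f x)%:E @[i --> \oo] --> \int[mu]_(x in `]a, b[) (f x)%:E)%E.
    rewrite -bE; apply: ge0_nondecreasing_set_cvg_integral => //.
    - apply/nondecreasing_seqP => n; rewrite subsetEset /E; apply: subset_itv.
        rewrite bnd_simp /u lerD2l ler_pM2l// lef_pV2 ?posrE// ler_nat//.
      by rewrite bnd_simp /v lerD2l lerN2 ler_pM2l// lef_pV2 ?posrE// ler_nat.
    - move=> n; apply/measurable_EFinP; apply: measurable_funS mf => //.
      by move=> x; exact: subE.
    - by move=> n x xE; rewrite lee_fin; apply: f0; exact: (subE n).
  have h2 : ((F (v n) - F (u n))%:E @[n --> \oo] --> (F b - F a)%:E)%E.
    apply: cvg_EFin; first exact: nearW.
    apply: cvgB; [apply: (cvg_at_leftP _ _ _).1 Fb _ _|apply: (cvg_at_rightP _ _ _).1 Fa _ _];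
      by split => // n; have [? ? ?] := uv n.
  rewrite (eq_cvg _ _ int_E) in h1.
  exact: cvg_unique h1 h2.
have mfc : measurable_fun `[a, b] f.
  by apply/measurable_fun_itv_obnd_cbndP/measurable_fun_itv_bndo_bndcP.
split; last by rewrite /Rintegral integral_itv_bndoo ?int_oo//; exact/measurable_EFinP.
apply/integrableP; split; first exact/measurable_EFinP.
rewrite integral_itv_bndoo; last by apply: measurableT_comp => //; exact/measurable_EFinP.
under eq_integral => x /[!inE] xab do rewrite /= ger0_norm ?f0//.
by rewrite int_oo ltry.
Unshelve. all: by end_near. Qed.

Lemma has_integral_eq (a b : R) (f g : R -> R) v :
  {in `[a, b], f =1 g} -> has_integral a b f v -> has_integral a b g v.
Proof.
move=> fg [If <-]; split; last by apply/esym/eq_Rintegral => x; rewrite inE; exact: fg.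
by apply: eq_integrable If => // x /[!inE] xD /=; rewrite fg.
Qed.

Lemma has_integralD (a b : R) (f g : R -> R) u v :
  has_integral a b f u -> has_integral a b g v -> has_integral a b (fun x => f x + g x) (u + v).
Proof.
move=> [If <-] [Ig <-]; split; last exact: RintegralD.
by apply: eq_integrable (integrableD _ If Ig).
Qed.

Lemma has_integralZ (a b : R) (f : R -> R) k v :
  has_integral a b f v -> has_integral a b (fun x => k * f x) (k * v).
Proof.
move=> [If <-]; split; last exact: RintegralZl.
by apply: eq_integrable (integrableZl _ k If).
Qed.

Lemma has_integral_poly (a b : R) (w : R -> R) (c : nat -> R^o) :
  (forall k, has_integral a b (fun x => w x * x ^+ k) (c k)) ->
  forall p : {poly R}, has_integral a b (fun x => w x * p.[x]) (linext c p).
Proof.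
move=> wX; elim/poly_linear_ind => [k|e p q wp wq].
  by rewrite linextXn; apply: has_integral_eq (wX k) => x _; rewrite hornerXn.
rewrite linearP/=; apply: has_integral_eq (has_integralD (has_integralZ e wp) wq) => x _ /=.
by rewrite hornerD hornerZ; ring.
Qed.

(** From ln t < t at t = 1 / sqrt u one gets |u ln u| <= 2 sqrt u on (0, 1]. The
    limit is two-sided because ln is 0 on nonpositive reals. *)
Lemma cvg_xlnx0 : (fun u : R => u * ln u) @ (0 : R) --> (0 : R).
Proof.
have bnd (u : R) : 0 < u -> u <= 1 -> `|u * ln u| <= 2 * Num.sqrt u.
  move=> u0 u1; have s0 : 0 < Num.sqrt u by rewrite sqrtr_gt0.
  have := ln_sublinear (_ : 0 < (Num.sqrt u)^-1); rewrite invr_gt0 => /(_ s0).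
  rewrite lnV ?posrE// => h.
  have uE : u = Num.sqrt u ^+ 2 by rewrite sqr_sqrtr// ltW.
  rewrite ler0_norm; last by rewrite mulr_ge0_le0 ?ln_le0// ltW.
  rewrite {1 2}uE lnXn// -mulrN -mulNrn.
  have : Num.sqrt u * - ln (Num.sqrt u) <= 1 by rewrite mulrC -ler_pdivlMr// div1r ltW.
  move=> h2; rewrite expr2; move: (Num.sqrt u) (ln _) s0 h2 => s l s0 h2; nra.
have csq : 2 * Num.sqrt `|u| @[u --> (0 : R)] --> 2 * Num.sqrt `|0 : R|.
  apply: cvgM; first exact: cvg_cst.
  by apply: continuous_cvg; [exact: sqrt_continuous|exact: norm_continuous].
rewrite normr0 sqrtr0 mulr0 in csq.
apply/cvgr0Pnorm_lt => e e0.
near=> u.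
have [u0|u0] := leP u 0; first by rewrite ln0// mulr0 normr0.
apply: (le_lt_trans (bnd _ u0 _)).
  near: u. exact: cvgr_le (@cvg_id _ (nbhs (0:R))) _ ltr01.
rewrite -[X in Num.sqrt X]gtr0_norm//.
near: u; exact: cvgr_lt csq _ e0.
Unshelve. all: by end_near. Qed.

Lemma ge0_has_integral_derive (f F : R -> R) (a b : R) : a < b ->
  {in `]a, b[, continuous f} -> {in `]a, b[, forall x, 0 <= f x} ->
  {in `]a, b[, forall x : R, is_derive x (1 : R) F (f x)} ->
  {for a, continuous F} -> {for b, continuous F} ->
  has_integral a b f (F b - F a).
Proof.
move=> ab cf f0 dF Fa Fb; apply: ge0_has_integral => //.
  split; [by move=> x /dF []|exact: cvg_at_right_filter|exact: cvg_at_left_filter].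
by move=> x xab; rewrite derive1E; have [_] := dF x xab.
Qed.

Lemma has_integral_derive (p : {poly R}) (a b : R) : a < b ->
  has_integral a b (horner p^`()) (p.[b] - p.[a]).
Proof.
move=> ab; have cp' : {within `[a, b], continuous (horner p^`())}.
  by apply: continuous_subspaceT; exact: continuous_horner.
split; first by apply: continuous_compact_integrable => //; exact: segment_compact.
rewrite /Rintegral (continuous_FTC2 (F := horner p))//.
  split; [by move=> x _; exact: derivable_horner|apply: cvg_at_right_filter|apply: cvg_at_left_filter];
    exact: continuous_horner.
by move=> x _; rewrite derivE.
Qed.

Lemma continuous_xlnx : {for 0, continuous (fun u : R => u * ln u)}.
Proof. by rewrite /prop_for /continuous_at/= mul0r; exact: cvg_xlnx0. Qed.

(** The integrand is nonpositive, so the fundamental theorem is applied to its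
    opposite, with antiderivative x^(k+1) / (k+1)^2 - x^(k+1) ln(x) / (k+1). *)
Lemma has_integral_lnXn k :
  has_integral 0 1 (fun x => ln x * x ^+ k) (- (k.+1%:R ^- 2)).
Proof.
pose c : R := k.+1%:R; have c0 : c != 0 by rewrite pnatr_eq0.
pose P : {poly R} := (c ^- 2) *: 'X^(k.+1).
pose Q : {poly R} := c^-1 *: 'X^(k.+1).
pose F : R -> R := horner P - (horner Q * @ln R).
(* Displayed in this way, F is visibly continuous at 0. *)
have FE (x : R) : F x = P.[x] - c^-1 * x ^+ k * (x * ln x).
  have QE : Q.[x] = c^-1 * x ^+ k * x by rewrite /Q hornerZ hornerXn exprSr mulrA.
  by rewrite mulrA -QE.
have dF (x : R) : 0 < x -> is_derive x (1 : R) F (- ln x * x ^+ k).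
  move=> x0.
  have x0' : x != 0 by rewrite gt_eqF.
  have E : P^`().[x] - (Q.[x] * x^-1 + ln x * Q^`().[x]) = - ln x * x ^+ k.
    rewrite /P /Q !derivZ !derivXn !hornerZ !hornerMn !hornerXn -mulr_natr -/c.
    by rewrite (exprSr x k); clearbody c; field; rewrite x0' c0.
  have := is_deriveB (is_derive_poly P x) (is_deriveM (is_derive_poly Q x) (is_derive1_ln x0)).
  by move/trigger_derive; apply.
have cont1 : {for 1, continuous F}.
  by have [/derivable1_diffP/differentiable_continuous] := dF 1 ltr01.
have cont0 : {for 0, continuous F}.
  rewrite (_ : F = fun x : R => P.[x] - c^-1 * x ^+ k * (x * ln x)); last exact/funext.
  apply: cvgB; first exact: continuous_horner.
  apply: cvgM; last exact: continuous_xlnx.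
  apply: cvgM; first exact: cvg_cst.
  exact: exprn_continuous.
have := @ge0_has_integral_derive (fun x => - ln x * x ^+ k) F 0 1 ltr01.
have -> : F 1 - F 0 = c ^- 2.
  by rewrite !FE ln1 /P !hornerZ !hornerXn !expr1n expr0n !(mul0r, mulr0, subr0, mulr1).
move=> /(_ _ _ _ cont0 cont1) h.
rewrite -mulN1r; apply: has_integral_eq (has_integralZ (-1) (h _ _ _)).
- by move=> x _ /=; rewrite mulN1r mulNr opprK.
- move=> x; rewrite in_itv/= => /andP[x0 x1]; apply: cvgM.
    by apply: cvgN; exact: continuous_ln.
  exact: exprn_continuous.
- move=> x; rewrite in_itv/= => /andP[x0 x1].
  by rewrite mulr_ge0 ?exprn_ge0 ?oppr_ge0 ?ln_le0// ltW.
- by move=> x; rewrite in_itv/= => /andP[x0 x1]; exact: dF.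
Qed.

(** To have a nonnegative integrand, integrate (ln x - ln(x-y)) y^k instead. The
    antiderivative pairs the logarithm with P(y) = (y^(k+1) - x^(k+1)) / (k+1),
    which vanishes at the singularity y = x; the remaining term P(y) / (x-y) is
    minus the polynomial V, with primitive W, and W(x) gives the harmonic
    number. *)
Lemma has_integral_ln_subXn k (x : R) : 0 < x ->
  has_integral 0 x (fun y => ln (x - y) * y ^+ k)
    (ln x * (k.+1%:R^-1 * x ^+ k.+1) - harm R k.+1 / k.+1%:R * x ^+ k.+1).
Proof.
move=> x0.
pose c : R := k.+1%:R; have c0 : c != 0 by rewrite pnatr_eq0.
pose P : {poly R} := c^-1 *: ('X^(k.+1) - (x ^+ k.+1)%:P).
pose V : {poly R} := c^-1 *: \sum_(i < k.+1) x ^+ (k - i) *: 'X^i.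
pose W : {poly R} := c^-1 *: \sum_(i < k.+1) (x ^+ (k - i) / i.+1%:R) *: 'X^(i.+1).
have WV : W^`() = V.
  rewrite /W /V derivZ linear_sum/=; congr (_ *: _); apply: eq_bigr => i _.
  by rewrite derivZ derivXn -scalerMnr scalerMnl -mulr_natr divfK ?pnatr_eq0.
have PV (y : R) : P.[y] = - (x - y) * V.[y].
  rewrite /P hornerZ hornerD hornerN hornerC hornerXn -opprB subrXX mulrN mulNr; congr (- _).
  rewrite /V hornerZ horner_sum.
  rewrite mulrCA; congr (_ * (_ * _)); apply: eq_bigr => i _.
  by rewrite hornerZ hornerXn.
pose F : R -> R := horner P * (cst (ln x) - (@ln R \o (cst x - id))) + horner W.
(* Displayed in this way, F is visibly continuous at x. *)
have FE (y : R) : F y = P.[y] * ln x + V.[y] * ((x - y) * ln (x - y)) + W.[y].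
  by rewrite /F /= !fctE/= mulrBr [X in _ - X]mulrC; rewrite !PV; ring.
have dF (y : R) : y < x -> is_derive y (1 : R) F ((ln x - ln (x - y)) * y ^+ k).
  move=> yx; have xy : 0 < x - y by rewrite subr_gt0.
  have xy' : x - y != 0 by rewrite gt_eqF.
  have E : P.[y] * (0 - (x - y)^-1 * (0 - 1)) + (ln x - ln (x - y)) * P^`().[y] + V.[y]
      = (ln x - ln (x - y)) * y ^+ k.
    rewrite PV /P derivZ derivB derivC derivXn subr0 hornerZ hornerMn hornerXn -mulr_natr -/c.
    by clearbody c; field; rewrite xy' c0.
  have dl := @is_derive1_comp _ (@ln R) (cst x - id) y _ _ (is_derive1_ln xy)
    (is_deriveB (is_derive_cst x y 1) (is_derive_id y 1)).
  have := is_deriveD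
    (is_deriveM (is_derive_poly P y) (is_deriveB (is_derive_cst (ln x) y 1) dl)) (is_derive_poly W y).
  by rewrite WV; move/trigger_derive; apply.
have cont0 : {for 0, continuous F}.
  by have [/derivable1_diffP/differentiable_continuous] := dF 0 x0.
have contx : {for x, continuous F}.
  rewrite (_ : F = fun y : R => P.[y] * ln x + V.[y] * ((x - y) * ln (x - y)) + W.[y]);
    last exact/funext.
  apply: cvgD; last exact: continuous_horner.
  apply: cvgD.
    by apply: cvgM; [exact: continuous_horner|exact: cvg_cst].
  apply: cvgM; first exact: continuous_horner.
  apply: (@continuous_comp _ _ _ (fun y => x - y) (fun u : R => u * ln u)).
    by apply: cvgB; [exact: cvg_cst|exact: cvg_id].
  by rewrite subrr; exact: continuous_xlnx.
have := @ge0_has_integral_derive (fun y => (ln x - ln (x - y)) * y ^+ k) F 0 x x0.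
have -> : F x - F 0 = harm R k.+1 / c * x ^+ k.+1.
  have -> : F x - F 0 = W.[x] - W.[0] by rewrite !FE !PV !subr0; ring.
  have -> : W.[0] = 0.
    rewrite /W hornerZ horner_sum big1 ?mulr0// => i _.
    by rewrite hornerZ hornerXn expr0n mulr0.
  rewrite subr0 /W hornerZ horner_sum /harm !mulr_suml mulr_sumr.
  apply: eq_bigr => i _; rewrite hornerZ hornerXn.
  have -> : x ^+ k.+1 = x ^+ (k - i) * x ^+ i.+1.
    by rewrite -exprD addnS subnK// -ltnS.
  by ring.
move=> /(_ _ _ _ cont0 contx) h.
have hX := has_integral_derive (c^-1 *: 'X^(k.+1)) x0.
rewrite derivZ derivXn !hornerZ !hornerXn expr0n mulr0 subr0 in hX.
have Xk (y : R) : (c^-1 *: ('X^k *+ k.+1) : {poly R}).[y] = y ^+ k.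
  by rewrite hornerZ hornerMn hornerXn -mulr_natl mulKf.
rewrite -[X in _ - X]mul1r -mulNr.
apply: has_integral_eq (has_integralD (has_integralZ (ln x) hX) (has_integralZ (- (1 : R)) (h _ _ _))).
- by move=> y _ /=; rewrite Xk; ring.
- move=> y; rewrite in_itv/= => /andP[y0 yx]; apply: cvgM; last exact: exprn_continuous.
  apply: cvgB; first exact: cvg_cst.
  apply: (@continuous_comp _ _ _ (fun y => x - y) (@ln R)).
    by apply: cvgB; [exact: cvg_cst|exact: cvg_id].
  by apply: continuous_ln; rewrite subr_gt0.
- move=> y; rewrite in_itv/= => /andP[y0 yx].
  rewrite mulr_ge0 ?exprn_ge0 ?(ltW y0)// subr_ge0 ler_ln ?posrE ?subr_gt0//.
  by rewrite gerBl ltW.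
- by move=> y; rewrite in_itv/= => /andP[y0 yx]; exact: dF.
Qed.

Lemma has_integral_int01 (p : {poly R}) : has_integral 0 1 (horner p) (int01 p).
Proof.
have := has_integral_derive (prim p) ltr01.
by rewrite deriv_prim prim_at1 prim_at0 subr0.
Qed.

Lemma has_integral_ln_sub (g : {poly R}) (x : R) : 0 < x ->
  has_integral 0 x (fun y => ln (x - y) * g.[y]) (ln x * (prim g).[x] - (hprim g).[x]).
Proof.
move=> x0; have := has_integral_poly (fun k => has_integral_ln_subXn k x0) g.
congr has_integral; elim/poly_linear_ind: g => [k|a p q hp hq].
  by rewrite linextXn primXn hprimXn !hornerZ !hornerXn.
by rewrite !linearP/= hp hq !hornerD !hornerZ /GRing.scale/=; ring.
Qed.

(** The inner integral is linear in g and its value ln(x) G(x) - S(x) can be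
    integrated against f term by term. *)
Lemma logformE (f g : {poly R}) :
  \int[mu]_(x in `[0, 1]) \int[mu]_(y in `[0, x]) (ln (x - y) * f.[x] * g.[y]) =
  logform f g.
Proof.
have [_ <-] : has_integral 0 1
    (fun x => ln x * (f * prim g).[x] + -1 * (f * hprim g).[x]) (logform f g).
  have := has_integralD (has_integral_poly has_integral_lnXn (f * prim g))
    (has_integralZ (-1) (has_integral_int01 (f * hprim g))).
  by rewrite mulN1r.
apply: eq_Rintegral => x; rewrite inE/= in_itv/= => /andP[].
(* At x = 0 the inner integral is over a point, and both G and S vanish. *)
rewrite le_eqVlt => /predU1P[<- _|x0 _].
  have hprim0 : (hprim g).[0] = 0.
    elim/poly_linear_ind: g => [k|a p q hp hq]; last first.
      by rewrite !linearP/= !hornerD !hornerZ hp hq mulr0 addr0.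
    by rewrite hprimXn hornerZ hornerXn expr0n mulr0.
  by rewrite set_itv1 Rintegral_set1 !hornerM prim_at0 hprim0 !mulr0 addr0.
have [_ ->] : has_integral 0 x (fun y => ln (x - y) * f.[x] * g.[y])
    (f.[x] * (ln x * (prim g).[x] - (hprim g).[x])).
  apply: has_integral_eq (has_integralZ f.[x] (has_integral_ln_sub g x0)) => y _ /=.
  by ring.
by rewrite !hornerM; ring.
Qed.
End improper.

(** * The theorem *)

Section shifted_legendre.
Variables (R : realType) (P : nat -> {poly R}).
Hypothesis hP : legendre_family P.

Definition pshift (n : nat) : {poly R} := P n \Po (2 *: 'X - 1).

Lemma horner_pshift n x : (pshift n).[x] = shifted P n x.
Proof. by rewrite /pshift /shifted horner_comp hornerD hornerN hornerZ hornerX hornerC. Qed.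

Lemma size_pshift n : size (pshift n) = n.+1.
Proof.
rewrite /pshift size_comp_poly2 ?(legendre_size hP)//.
have sX : size (2 *: 'X : {poly R}) = 2 by rewrite size_scale ?pnatr_eq0// size_polyX.
by rewrite size_polyDl sX// size_polyN size_poly1.
Qed.

Lemma pshift_at1 n : (pshift n).[1] = 1.
Proof.
rewrite horner_pshift /shifted -[RHS](legendre_at1 hP n); congr (_.[_]); ring.
Qed.

(** Both sides are increments of the antiderivative [prim q], the left one after
    composition with the affine map 2x - 1. *)
Lemma int01_comp_affine (q : {poly R}) :
  int01 (q \Po (2 *: 'X - 1)) = 2^-1 * \int[lebesgue_measure]_(x in `[-1, 1]) q.[x].
Proof.
have N11 : -1 < 1 :> R by lra.
have [_] := has_integral_derive (prim q) N11; rewrite deriv_prim => ->.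
have := int01_deriv (prim q \Po (2 *: 'X - 1)).
rewrite deriv_comp deriv_prim derivB derivZ derivX derivC subr0 -scalerAr mulr1 int01Z.
rewrite !horner_comp !hornerD !hornerN !hornerZ !hornerX !hornerC.
have -> : 2 * 1 - 1 = 1 :> R by ring.
have -> : 2 * 0 - 1 = -1 :> R by ring.
by move=> <-; rewrite mulKf// pnatr_eq0.
Qed.

Lemma pshift_orth m n : m != n -> int01 (pshift m * pshift n) = 0.
Proof.
move=> mn; rewrite /pshift -rmorphM/= int01_comp_affine.
under eq_Rintegral do rewrite hornerM.
by rewrite (legendre_orth hP mn) mulr0.
Qed.

Lemma Ltilde'_logform m n : Ltilde' P m n = lform pshift m n.
Proof.
rewrite /lform -logformE; apply: eq_Rintegral => x _; apply: eq_Rintegral => y _.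
by rewrite !horner_pshift.
Qed.
End shifted_legendre.

Lemma HoddE (R : realType) n : Hodd R (2 * n + 1) = \sum_(i < n.+1) (2 * i%:R + 1)^-1.
Proof.
rewrite /Hodd; elim: n => [|n IH].
  by rewrite big_ord1 big_mkcond big_nat1/= mulr0 add0r.
rewrite big_ord_recr/= -IH !addn1 mulnS !add2n.
rewrite big_mkcond big_nat_recr//= big_nat_recr//= -big_mkcond/= oddM/= addr0.
by congr (_ + _^-1); rewrite -addn3 natrD natrM -natr1; ring.
Qed.

Theorem theorem4 (R : realType) (P : nat -> {poly R}) (hP : legendre_family P) :
  (forall m n : nat, (n <= m)%N ->
     (2 <= m - n)%N \/ (m = n /\ n <> 0%N) ->
     Ltilde' P m n =
       (-1) ^+ (m - n) /
       ((m%:R + n%:R) * (m%:R + n%:R + 2) * ((m%:R - n%:R) ^+ 2 - 1)))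
  /\
  (forall n : nat,
     let q : R := (2 * n%:R + 1) * (2 * n%:R + 3) in
     Ltilde' P n.+1 n = - (1 / q) * (Hodd R (2 * n + 1)%N - 1 / 4 - 1 / q)).
Proof.
pose sizeP := size_pshift hP; pose orthP := pshift_orth hP; pose at1P := pshift_at1 hP.
split=> [m n nm [mn|[-> n0]]|n q]; rewrite Ltilde'_logform.
- have nm2 : (n.+2 <= m)%N by rewrite -addn2 -leq_subRL.
  rewrite (lform_offdiag sizeP orthP at1P nm2); congr (_ / _).
  by rewrite -[LHS]signr_odd -[RHS]signr_odd oddB// oddD.
- case: n n0 {nm} => // n _.
  rewrite (lform_diag sizeP orthP at1P) subnn subrr expr0n expr0 sub0r mulrN1 div1r invrN.
  by rewrite -natr1; congr (- (_ * _)^-1); ring.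
- by rewrite (lform_sub sizeP orthP at1P) HoddE.
Qed.
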